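(* Let $T>0$, let $(\mathcal{P}_N)_{N\in\mathbb{N}}$ be a quasi-uniform sequence of partitions of $[0,T]$, and let $f\sim\mathcal{GP}(0,k_{l,H})$ on $[0,T]$ with $l\in\{0,1\}$ and $0<H<1$, where $k_{0,H}$ is the fractional Brownian motion kernel and $k_{1,H}$ the integrated fractional Brownian motion kernel with Hurst parameter $H$. Let $\hat{\sigma}_{\mathrm{ML}}^2$ be the maximum likelihood estimator of the scale parameter for the Brownian motion kernel computed from the values of $f$ at the points of $\mathcal{P}_N$. Then, as $N\to\infty$, $$\mathbb{E}\,\hat{\sigma}_{\mathrm{ML}}^2=\Theta\big(N^{1-\min\{2(l+H),2\}}\big)=\begin{cases}\Theta(N^{1-2H})&\text{if } l=0 \text{ and } H\in(0,1),\\ \Theta(N^{-1})&\text{if } l=1\text{ and }H\in(0,1).\end{cases}$$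
   Context: Partitions: for each $N\in\mathbb{N}$, $\mathcal{P}_N=(x_{N,n})_{n=1}^N\subset[0,T]$ with $0=:x_{N,0}<x_{N,1}<\dots<x_{N,N}=T$; write $x_n$ for $x_{N,n}$. With $\Delta x_{N,n}=x_{N,n+1}-x_{N,n}$, $n=0,\dots,N-1$, the sequence $(\mathcal{P}_N)$ is quasi-uniform if there is a constant $1\le C_{\mathrm{qu}}<\infty$ such that $\sup_{N\in\mathbb{N}}\frac{\max_n\Delta x_{N,n}}{\min_n\Delta x_{N,n}}=C_{\mathrm{qu}}$. $\mathcal{GP}(0,\kappa)$ denotes the Gaussian process with zero mean function and covariance function $\kappa$. For $0<H<1$, $$k_{0,H}(x,x')=\tfrac12\big(|x|^{2H}+|x'|^{2H}-|x-x'|^{2H}\big),\qquad k_{1,H}(x,x')=\int_0^x\int_0^{x'}k_{0,H}(z,z')\,\mathrm{d}z'\,\mathrm{d}z .$$ Maximum likelihood estimator: let $k(x,x')=\min(x,x')$ on $[0,T]$ (Brownian motion kernel), $\mathbf{x}=(x_1,\dots,x_N)$, $f(\mathbf{x})=(f(x_1),\dots,f(x_N))^\top$ and $k(\mathbf{x},\mathbf{x})=(k(x_i,x_j))_{i,j=1}^N$ (which is non-singular). Then $$\hat{\sigma}_{\mathrm{ML}}^2=\frac{f(\mathbf{x})^\top k(\mathbf{x},\mathbf{x})^{-1}f(\mathbf{x})}{N}.$$ $a_N=\Theta(b_N)$ means that there are constants $0<c\le C<\infty$ with $c\,b_N\le a_N\le C\,b_N$ for all sufficiently large $N$. *)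

(* Defs.v *)
From HB Require Import structures.
From mathcomp Require Import all_boot all_order all_algebra.
From mathcomp Require Import all_classical all_reals all_analysis.

Set Implicit Arguments.
Unset Strict Implicit.
Unset Printing Implicit Defensive.

Import Order.TTheory GRing.Theory Num.Theory.
Import numFieldNormedType.Exports.

Local Open Scope classical_set_scope.
Local Open Scope ring_scope.

(* The points 0 = x 0 < x 1 < ... < x N = T; the values x n for n > N are
   irrelevant. No x satisfies this for N = 0 when T > 0, which is why sequences
   of partitions are indexed by N >= 1 below. *)
Definition is_partition (R : realType) (T : R) (N : nat) (x : nat -> R) :=
  [/\ x 0%N = 0, x N = T & forall n, (n < N)%N -> x n < x n.+1].

Definition mesh (R : realType) (x : nat -> R) (n : nat) : R := x n.+1 - x n.

(* For N >= 1 the starting value mesh x 0 is one of the terms, so these are the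
   maximum and the minimum of mesh x n over n = 0, ..., N - 1. *)
Definition max_mesh (R : realType) (N : nat) (x : nat -> R) : R :=
  \big[Num.max/mesh x 0]_(n < N) mesh x n.

Definition min_mesh (R : realType) (N : nat) (x : nat -> R) : R :=
  \big[Num.min/mesh x 0]_(n < N) mesh x n.

(* x N n stands for the n-th point of the N-th partition. *)
Definition quasi_uniform (R : realType) (x : nat -> nat -> R) :=
  exists2 C : R, 1 <= C &
    ereal_sup [set (max_mesh N (x N) / min_mesh N (x N))%:E
              | N in [set N | (0 < N)%N]] = C%:E.

(* Law N(m, s^2), with s = 0 read as the point mass at m: the library's
   normal_prob m 0 is the uniform law on [0, 1]. *)
Definition gaussian_law (R : realType) (m s : R) : set R -> \bar R :=
  if s == 0 then \d_m else normal_prob m s.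

Definition gaussian_rv (d : measure_display) (Omega : measurableType d)
    (R : realType) (P : probability Omega R) (X : Omega -> R) :=
  exists m s : R, forall A : set R, measurable A ->
    P (X @^-1` A) = gaussian_law m s A.

(* The finite-dimensional distributions are multivariate Gaussian (possibly
   degenerate) in the sense that all linear combinations of the coordinates are
   Gaussian; their means and covariances are given by m and k. Only the values
   of the process at the points of D are constrained. *)
Definition gaussian_process (d : measure_display) (Omega : measurableType d)
    (R : realType) (P : probability Omega R) (D : set R)
    (m : R -> R) (k : R -> R -> R) (f : R -> {RV P >-> R}) :=
  [/\ forall (n : nat) (t a : 'I_n -> R), (forall i, D (t i)) ->
        gaussian_rv P (fun w => \sum_(i < n) a i * f (t i) w),
      forall x, D x -> ('E_P[f x] = (m x)%:E)%E
    & forall x y, D x -> D y -> covariance P (f x) (f y) = (k x y)%:E].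

Definition fbm_kernel (R : realType) (H x y : R) : R :=
  2^-1 * (`|x| `^ (2 * H) + `|y| `^ (2 * H) - `|x - y| `^ (2 * H)).

(* Meant for 0 <= x and 0 <= y: the integrals are over the sets [0, x] and
   [0, y]. *)
Definition ifbm_kernel (R : realType) (H x y : R) : R :=
  \int[lebesgue_measure]_(z in `[0, x])
    \int[lebesgue_measure]_(z' in `[0, y]) fbm_kernel H z z'.

(* k_{l,H}, used for l = 0 and l = 1 only. *)
Definition hurst_kernel (R : realType) (l : nat) (H : R) : R -> R -> R :=
  if l == 0%N then fbm_kernel H else ifbm_kernel H.

Definition bm_kernel (R : realType) (x y : R) : R := Num.min x y.

Definition sample (R : realType) (N : nat) (f : R -> R) (x : 'I_N -> R) :
  'cV[R]_N := \col_i f (x i).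

Definition gram (R : realType) (N : nat) (k : R -> R -> R) (x : 'I_N -> R) :
  'M[R]_N := \matrix_(i, j) k (x i) (x j).

Definition sigma2_ML (R : realType) (N : nat) (k : R -> R -> R)
    (x : 'I_N -> R) (f : R -> R) : R :=
  ((sample f x)^T *m invmx (gram k x) *m sample f x) 0 0 / N%:R.

(* a is extended real valued, as expectations are; a = Theta(b) makes a N
   finite for all large N. *)
Definition is_Theta (R : realType) (a : nat -> \bar R) (b : nat -> R) :=
  exists c C : R, [/\ 0 < c, c <= C &
    \forall N \near \oo, ((c * b N)%:E <= a N <= (C * b N)%:E)%E].

(* Main.v *)
(* For the Brownian motion kernel the Gram matrix factors as L D L^T with L the
   lower triangular matrix of ones and D the diagonal matrix of the mesh sizes,
   so f(x)^T k(x,x)^-1 f(x) is the sum of the squared increments of f divided by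
   the mesh sizes, and only second moments of the process matter. The increments
   of fractional Brownian motion have variance Delta^(2H), so each term is of
   order N^(1 - 2H) by quasi-uniformity. For the integrated process the variance
   is the integral of k_{0,H} over a cell squared: it is at most
   T^(2H) Delta^2, and at least c Delta^2 on the cells of the second half of the
   partition, since k_{0,H}(z,z') >= a^(2H) - Delta^(2H)/2 for z, z' >= a within
   distance Delta. The remaining terms are nonnegative, being variances. *)

Require Import Defs.
From HB Require Import structures.
From mathcomp Require Import all_boot all_order all_algebra.
From mathcomp Require Import all_classical all_reals all_analysis.
From mathcomp Require Import ring lra zify measurable_realfun.

Set Implicit Arguments.
Unset Strict Implicit.
Unset Printing Implicit Defensive.

Import Order.TTheory GRing.Theory Num.Theory.
Import numFieldNormedType.Exports.

Local Open Scope classical_set_scope.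
Local Open Scope ring_scope.


(** * Partitions and the factorised Brownian quadratic form *)

Lemma partition_le (R : realType) (T : R) (N : nat) (x : nat -> R) (m n : nat) :
  is_partition T N x -> (m <= n)%N -> (n <= N)%N -> x m <= x n.
Proof.
move=> [_ _ x_lt]; elim: n => [|n IH]; first by rewrite leqn0 => /eqP ->.
rewrite leq_eqVlt => /predU1P[->//|mn nN].
by rewrite (le_trans (IH mn (ltnW nN)))// ltW// x_lt.
Qed.

Lemma sum_mesh (R : realType) (T : R) (N : nat) (x : nat -> R) :
  is_partition T N x -> \sum_(n < N) mesh x n = T.
Proof.
move=> [x0 xN _].
by rewrite -xN -[RHS]subr0 -[X in _ - X]x0 -telescope_sumr// big_mkord.
Qed.

(** Since [x] is nondecreasing, the smaller of two nodes is the node of smaller index. Telescoping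
    from [x 0 = 0] writes it as the sum of the meshes over those [n] with [n <= i] and [n <= j], and
    this is the entry of the triple product. *)
Lemma gram_bm_LDL (R : realType) (T : R) (N : nat) (x : nat -> R) :
  is_partition T N x ->
  let L := \matrix_(i < N, j < N) ((j <= i)%N%:R : R) in
  gram (@bm_kernel R) (fun i : 'I_N => x i.+1) =
    L *m diag_mx (\row_(j < N) mesh x j) *m L^T.
Proof.
move=> x_part /=; have [x0 _ _] := x_part; apply/matrixP => i j; rewrite !mxE /bm_kernel.
under eq_bigr => n _.
  rewrite mxE (bigD1 n) //= big1 => [|m mn]; last first.
    by rewrite !mxE (negPf mn) mulr0n mulr0.
  rewrite !mxE eqxx mulr1n addr0 mulrAC -natrM mulnb; over.
transitivity (x (minn i j).+1).
  have [ij|/ltnW ji] := leqP i j.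
    by apply/min_idPl/(partition_le x_part).
  by apply/min_idPr/(partition_le x_part).
set p := (minn i j).+1.
have pN : (p <= N)%N by rewrite /p (leq_ltn_trans (geq_minl _ _)).
rewrite -[LHS]subr0 -[X in _ - X = _]x0 -telescope_sumr // big_mkord.
rewrite (big_ord_widen N (mesh x)) // big_mkcond; apply: eq_bigr => n _.
rewrite /p ltnS leq_min.
by case: (_ && _); rewrite ?mul1r ?mul0r.
Qed.

(** The sequence [g] agrees with [f] at the sampled nodes and is set to [0] at index [0], so [f 0]
    itself may take any value. *)
Lemma sigma2_ML_bm (R : realType) (T : R) (N : nat) (x g : nat -> R) (f : R -> R) :
  is_partition T N x ->
  g 0%N = 0 -> (forall n, (n < N)%N -> g n.+1 = f (x n.+1)) ->
  sigma2_ML (@bm_kernel R) (fun i : 'I_N => x i.+1) f =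
    (\sum_(n < N) (g n.+1 - g n) ^+ 2 / mesh x n) / N%:R.
Proof.
move=> x_part g0 gE; have [x0 _ x_lt] := x_part; rewrite /sigma2_ML; congr (_ / _).
set K := gram _ _; set v := sample _ _.
have KE := gram_bm_LDL x_part; rewrite /= -/K in KE.
set L := \matrix_(i, j) _ in KE; set D := diag_mx _ in KE.
have mesh_neq0 (n : 'I_N) : mesh x n != 0 by rewrite subr_eq0 gt_eqF// x_lt.
have uL : L \in unitmx.
  rewrite unitmxE det_trig; last first.
    by apply/is_trig_mxP => i j ij; rewrite !mxE leqNgt ij.
  by rewrite big1 ?unitr1 // => i _; rewrite !mxE leqnn.
have uD : D \in unitmx.
  rewrite unitmxE det_diag unitfE; apply/prodf_neq0 => i _.
  by rewrite mxE.
have uK : K \in unitmx by rewrite KE !unitmx_mul uL uD unitmx_tr.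
pose dl := \col_(n < N) (g n.+1 - g n).
have vE : v = L *m dl.
  apply/colP => i; rewrite !mxE -gE // -[LHS]subr0 -[X in _ - X = _]g0 -telescope_sumr //.
  rewrite big_mkord (big_ord_widen N (fun n => g n.+1 - g n)) //.
  rewrite big_mkcond; apply: eq_bigr => n _.
  by rewrite !mxE ltnS; case: (_ <= _)%N; rewrite ?mul1r ?mul0r.
(* The quadratic form is [dl^T *m w]. Cancelling [L] in [L *m D *m w = v = L *m dl] gives
   [D *m w = dl], which determines [w] without an explicit inverse of [L]. *)
set w := L^T *m (invmx K *m v).
have Dw : D *m w = dl.
  apply: (can_inj (mulKmx uL)); rewrite -vE /w !mulmxA -KE.
  by rewrite mulmxV ?mul1mx.
have wE n : w n 0 = (g n.+1 - g n) / mesh x n.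
  have := congr1 (fun A : 'cV_N => A n 0) Dw.
  rewrite mul_diag_mx !mxE => <-.
  by rewrite mulrAC divff ?mul1r.
rewrite -mulmxA vE trmx_mul -mulmxA -vE -/w mxE; apply: eq_bigr => n _.
by rewrite wE !mxE expr2 mulrA.
Qed.

(** * Second moments of random variables *)

Section second_moments.
Context d (T : measurableType d) (R : realType) (P : probability T R).

Lemma Lfun2_second_moment (X : {RV P >-> R}) :
  ('E_P[X \* X] < +oo)%E -> (X : T -> R) \in Lfun P 2%:E.
Proof.
move=> XX; rewrite inE; apply/andP; split; rewrite inE /=.
  exact: measurable_funPT.
rewrite /finite_norm unlock /Lnorm /= poweR_lty//.
under eq_integral => w _ do rewrite powR_mulrn// real_normK ?num_real//.
by move: XX; rewrite unlock.
Qed.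

Lemma expectation_sqr_sub (X Y : T -> R) (a b c : R) :
  X \in Lfun P 2%:E -> Y \in Lfun P 2%:E ->
  ('E_P[X \* X] = a%:E -> 'E_P[X \* Y] = b%:E -> 'E_P[Y \* Y] = c%:E ->
   'E_P[fun w => ((Y w - X w) ^+ 2)%R] = (c - b - (b - a))%:E)%E.
Proof.
move=> LX LY aE bE cE.
have LXX := Lfun2_mul_Lfun1 LX LX; have LXY := Lfun2_mul_Lfun1 LX LY.
have LYY := Lfun2_mul_Lfun1 LY LY.
rewrite (_ : (fun w => _) = ((Y \* Y) \- (X \* Y)) \- ((X \* Y) \- (X \* X))); last first.
  by apply/funext => w /=; ring.
by rewrite !expectationB ?rpredB// aE bE cE.
Qed.

Lemma expectation_centered_mul (X Y : T -> R) (c : \bar R) :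
  ('E_P[X] = 0 -> 'E_P[Y] = 0 -> covariance P X Y = c -> 'E_P[X \* Y] = c)%E.
Proof.
rewrite covariance.unlock => -> -> <-; congr expectation.
by apply/funext => w; change (X w * Y w = (X w - 0) * (Y w - 0)); rewrite !subr0.
Qed.

Lemma expectation_weighted_sum (N : nat) (X : 'I_N -> T -> R) (v a : 'I_N -> R) (m : R) :
  (forall n, X n \in Lfun P 2%:E) ->
  (forall n, 'E_P[fun w => (X n w ^+ 2)%R] = (v n)%:E)%E ->
  ('E_P[fun w => ((\sum_(n < N) X n w ^+ 2 / a n) / m)%R] =
   ((\sum_(n < N) v n / a n) / m)%:E)%E.
Proof.
move=> LX vE.
pose Z n : T -> R := fun w => X n w ^+ 2.
have iX n : P.-integrable setT (EFin \o Z n) by exact: Lfun2_integrable_sqr.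
have vEZ n : (\int[P]_w (Z n w)%:E = (v n)%:E)%E by rewrite -vE unlock.
have sumE w : (((\sum_(n < N) X n w ^+ 2 / a n) / m)%:E =
    \sum_(n < N) (a n * m)^-1%:E * (EFin \o Z n) w)%E.
  rewrite sumEFin /= mulr_suml; congr EFin.
  by apply: eq_bigr => n _; rewrite /Z invfM; ring.
rewrite unlock; under eq_integral do rewrite sumE.
rewrite integral_sum//; last by move=> n; exact: integrableZl.
rewrite mulr_suml -sumEFin; apply: eq_bigr => n _.
by rewrite integralZl// vEZ -EFinM invfM; congr EFin; ring.
Qed.

End second_moments.

(** * Integrals of bounded kernels over cells *)

(** The integral over [B] is that of the kernel times the indicator of [B]; the integrals of its
    positive and negative parts are measurable in the parameter by Tonelli. *)
Lemma measurable_fun_Rintegral_param d1 d2 (T1 : measurableType d1)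
    (T2 : measurableType d2) (R : realType)
    (m : {sigma_finite_measure set T2 -> \bar R}) (B : set T2)
    (k : T1 -> T2 -> R) :
  measurable B -> measurable_fun setT (fun p => k p.1 p.2) ->
  measurable_fun setT (fun x => \int[m]_(y in B) k x y).
Proof.
move=> mB mk.
pose h : T1 * T2 -> \bar R := fun p => (k p.1 p.2 * \1_B p.2)%:E.
have mh : measurable_fun [set: T1 * T2] h.
  apply/measurable_EFinP/measurable_funM => //.
  by apply: measurableT_comp => //; exact: measurable_indic.
have -> : (fun x => \int[m]_(y in B) k x y) = fine \o (fun x =>
    (\int[m]_y (h^\+ (x, y))) - (\int[m]_y (h^\- (x, y))))%E.
  apply/funext => x; rewrite /Rintegral /=; congr fine.
  rewrite integral_mkcond integralE.
  have E y : ((EFin \o k x) \_ B) y = h (x, y).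
    rewrite /h patchE indicE /=.
    by case: ifPn => /= _; rewrite ?mulr1 ?mulr0.
  by congr (_ - _)%E; apply: eq_integral => y _; rewrite !(funeposE, funenegE) E.
apply: measurableT_comp => //; apply: emeasurable_funB.
- apply: measurable_fun_fubini_tonelli_F => //.
  exact: measurable_funepos.
- apply: measurable_fun_fubini_tonelli_F => //.
  exact: measurable_funeneg.
Qed.

Section double_integral.
Context (R : realType).
Notation mu := (@lebesgue_measure R).

Lemma bounded_integrable_itv (g : R -> R) (a b M : R) (u v : bool) :
  measurable_fun setT g ->
  (forall z, a <= z <= b -> `|g z| <= M) ->
  mu.-integrable [set` Interval (BSide u a) (BSide v b)] (EFin \o g).
Proof.
move=> mg gM; apply: measurable_bounded_integrable => //.
- rewrite /= lebesgue_measure_itv /=; case: ifP => // _.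
  by rewrite -EFinB ltry.
- exact: measurable_funTS.
- exists M; split; first exact: num_real.
  move=> y My z /= zab; rewrite (le_trans _ (ltW My))// gM//.
  by move: zab; rewrite itv_boundlr => /andP[]; case: u; case: v;
     rewrite !bnd_simp => h1 h2; apply/andP; split=> //; exact: ltW.
Qed.

Lemma Rintegral_itv_sub (g : R -> R) (a b M : R) :
  measurable_fun setT g -> 0 <= a <= b ->
  (forall z, 0 <= z <= b -> `|g z| <= M) ->
  \int[mu]_(z in `[0, b]) g z - \int[mu]_(z in `[0, a]) g z =
  \int[mu]_(z in `]a, b]) g z.
Proof.
move=> mg /andP[a0 ab] gM.
by rewrite Rintegral_itvB// ?bnd_simp//; exact: (@bounded_integrable_itv _ _ _ M).
Qed.

Lemma lebesgue_measure_itv_oc (a b : R) : a <= b -> mu `]a, b]%classic = (b - a)%:E.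
Proof.
rewrite le_eqVlt lebesgue_measure_itv /= lte_fin => /predU1P[->|ab].
  by rewrite ltxx subrr.
by rewrite ab EFinB.
Qed.

Lemma Rintegral_itv_bounds (g : R -> R) (a b m M : R) :
  measurable_fun setT g -> a <= b ->
  (forall z, a < z <= b -> m <= g z <= M) ->
  m * (b - a) <= \int[mu]_(z in `]a, b]) g z <= M * (b - a).
Proof.
move=> mg ab gM.
have cE (c : R) : \int[mu]_(z in `]a, b]) (cst c) z = c * (b - a).
  by rewrite Rintegral_cst//= lebesgue_measure_itv_oc.
have ig : mu.-integrable `]a, b] (EFin \o g).
  apply: measurable_bounded_integrable => //.
  - by rewrite /= lebesgue_measure_itv_oc// ltry.
  - exact: measurable_funTS.
  (* A value between [m] and [M] has absolute value at most [|m| + |M|], whatever the signs. *)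
  - exists (`|m| + `|M|); split; first exact: num_real.
    move=> y My z /=; rewrite in_itv /= => /gM /andP[mz zM].
    by rewrite (le_trans _ (ltW My))// ler_norml; move: (ler_norm M)
      (ler_norm (- m)) (normr_ge0 m) (normr_ge0 M); rewrite normrN; lra.
have ic (c : R) : mu.-integrable `]a, b] (EFin \o cst c).
  apply: measurable_bounded_integrable => //; last exact: bounded_cst.
  by rewrite /= lebesgue_measure_itv_oc// ltry.
by rewrite -!cE; apply/andP; split; apply: le_Rintegral => // z /=;
  rewrite in_itv /= => /gM /andP[].
Qed.

(* [I a b] and [I b a] are kept apart: identifying them would require Fubini. *)
Lemma double_integral_increment_bounds (k I : R -> R -> R) (a b M m m' : R) :
  measurable_fun setT (fun p : R * R => k p.1 p.2) ->
  0 <= a <= b ->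
  (forall z z', 0 <= z <= b -> 0 <= z' <= b -> `|k z z'| <= M) ->
  (forall z z', a < z <= b -> a < z' <= b -> m <= k z z' <= m') ->
  (forall x y, I x y = \int[mu]_(z in `[0, x]) \int[mu]_(z' in `[0, y]) k z z') ->
  m * (b - a) ^+ 2 <= I b b - I b a - (I a b - I a a) <= m' * (b - a) ^+ 2.
Proof.
move=> mk /[dup] /andP[a0 ab] a0b kM km IE0.
have b0 : 0 <= b by exact: le_trans ab.
have mk1 z : measurable_fun setT (k z).
  exact: (measurableT_comp mk (pair1_measurable z)).
pose G B z := \int[mu]_(z' in B) k z z'.
have mG B : measurable B -> measurable_fun setT (G B).
  by move=> mB; exact: measurable_fun_Rintegral_param.
have GB z y : 0 <= z <= b -> 0 <= y <= b -> `|G `[0, y]%classic z| <= M * y.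
  move=> z0b /andP[y0 yb].
  (* The estimate on []0, y]] passes to [[0, y]] because a point is a null set. *)
  have := @Rintegral_itv_bounds (k z) 0 y (- M) M (mk1 z) y0 _.
  rewrite Rintegral_itv_obnd_cbnd ?subr0 ?mulNr -?ler_norml.
    apply=> z' /andP[z'0 z'y]; rewrite -ler_norml kM// ltW//=.
    exact: le_trans yb.
  apply: (@bounded_integrable_itv _ _ _ M) => // z' /andP[z'0 z'y].
  by rewrite kM// z'0 (le_trans z'y).
have intG x y u v : 0 <= x -> v <= b -> 0 <= y <= b ->
  mu.-integrable [set` Interval (BSide u x) (BRight v)] (EFin \o G `[0, y]%classic).
  move=> x0 vb y0b; apply: (@bounded_integrable_itv _ _ _ (M * y)); first exact: mG.
  by move=> z /andP[xz zv]; rewrite GB// (le_trans x0)//= (le_trans zv).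
(* Differences are taken in the second argument first, inside the outer integral; this reduces the
   inner domain to []a, b]]. *)
have IE x : 0 <= x <= b -> I x b - I x a = \int[mu]_(z in `[0, x]) G `]a, b]%classic z.
  move=> /andP[x0 xb]; rewrite !IE0 -RintegralB//; last 2 first.
  - by apply: intG; rewrite // b0 lexx.
  - exact: intG.
  apply: eq_Rintegral => z; rewrite inE /= in_itv /= => /andP[z0 zx].
  rewrite /G -(@Rintegral_itv_sub _ _ _ M)// => z' z'0b.
  by rewrite kM// z0 (le_trans zx).
have GabB z : 0 <= z <= b -> `|G `]a, b]%classic z| <= M * b + M * a.
  move=> z0b; rewrite /G -(@Rintegral_itv_sub _ _ _ M)//; last first.
    by move=> z' z'0b; rewrite kM.
  by rewrite (le_trans (ler_normB _ _))// lerD// GB// b0 lexx.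
(* The difference in the first argument now leaves an integral over []a, b]] in both variables,
   where the bounds on [k] apply twice. *)
rewrite !IE ?b0 ?lexx// (@Rintegral_itv_sub _ _ _ (M * b + M * a))//; last exact: mG.
rewrite expr2 !mulrA; apply: Rintegral_itv_bounds => //; first exact: mG.
move=> z zab; apply: Rintegral_itv_bounds => // z' z'ab.
exact: km.
Qed.

End double_integral.

(** * Powers and fractional kernels *)

Lemma powR_nondecreasing (R : realType) (p u v : R) :
  0 <= p -> 0 <= u -> u <= v -> u `^ p <= v `^ p.
Proof. by move=> p0 u0 uv; rewrite ge0_ler_powR ?nnegrE// (le_trans u0). Qed.

Section fractional_kernels.
Context (R : realType) (H : R) (H_gt0 : 0 < H).
Implicit Types a b z : R.

Let H2_gt0 : 0 < 2 * H. Proof. by rewrite mulr_gt0. Qed.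

Let powR_le (u v : R) : 0 <= u -> u <= v -> u `^ (2 * H) <= v `^ (2 * H).
Proof. exact/powR_nondecreasing/ltW. Qed.

Lemma measurable_fbm_kernel :
  measurable_fun setT (fun p : R * R => fbm_kernel H p.1 p.2).
Proof.
apply: measurable_funM => //; apply: measurable_funB; first apply: measurable_funD.
- apply: (measurableT_comp (measurable_powR _)); exact: measurableT_comp.
- apply: (measurableT_comp (measurable_powR _)); exact: measurableT_comp.
- apply: (measurableT_comp (measurable_powR _)).
  by apply: measurableT_comp => //; exact: measurable_funB.
Qed.

Lemma fbm_kernel0 z : fbm_kernel H 0 z = 0.
Proof.
by rewrite /fbm_kernel normr0 powR0 ?gt_eqF// sub0r normrN add0r subrr mulr0.
Qed.

Lemma ifbm_kernel0 z : ifbm_kernel H 0 z = 0.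
Proof. by rewrite /ifbm_kernel set_itv1 Rintegral_set1. Qed.

Lemma fbm_increment a b :
  fbm_kernel H b b - fbm_kernel H b a - (fbm_kernel H a b - fbm_kernel H a a) =
  `|b - a| `^ (2 * H).
Proof.
rewrite /fbm_kernel !subrr normr0 powR0 ?gt_eqF// distrC; lra.
Qed.

(** Each of the three powers lies between [0] and the power of [b], and only one of them enters with
    a negative sign. *)
Lemma normr_fbm_kernel_le b z z' :
  0 <= z <= b -> 0 <= z' <= b -> `|fbm_kernel H z z'| <= b `^ (2 * H).
Proof.
move=> /andP[z0 zb] /andP[z'0 z'b]; rewrite /fbm_kernel (ger0_norm z0) (ger0_norm z'0).
have h1 := powR_le z0 zb; have h2 := powR_le z'0 z'b.
have h3 : `|z - z'| `^ (2 * H) <= b `^ (2 * H).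
  by apply: powR_le => //; rewrite ler_norml; lra.
have g1 := powR_ge0 z (2 * H); have g2 := powR_ge0 z' (2 * H).
have g3 := powR_ge0 `|z - z'| (2 * H).
by rewrite ler_norml; lra.
Qed.

Lemma fbm_kernel_ge a b z z' : 0 <= a -> a < z <= b -> a < z' <= b ->
  a `^ (2 * H) - (b - a) `^ (2 * H) / 2 <= fbm_kernel H z z'.
Proof.
move=> a0 /andP[az zb] /andP[az' z'b].
have z0 := le_trans a0 (ltW az); have z'0 := le_trans a0 (ltW az').
rewrite /fbm_kernel (ger0_norm z0) (ger0_norm z'0).
have h1 := powR_le a0 (ltW az); have h2 := powR_le a0 (ltW az').
have h3 : `|z - z'| `^ (2 * H) <= (b - a) `^ (2 * H).
  by apply: powR_le => //; rewrite ler_norml; lra.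
lra.
Qed.

Lemma ifbm_increment_bounds a b : 0 <= a <= b ->
  (a `^ (2 * H) - (b - a) `^ (2 * H) / 2) * (b - a) ^+ 2 <=
  ifbm_kernel H b b - ifbm_kernel H b a - (ifbm_kernel H a b - ifbm_kernel H a a)
  <= b `^ (2 * H) * (b - a) ^+ 2.
Proof.
move=> /[dup] ab /andP[a0 _].
apply: (@double_integral_increment_bounds _ (fbm_kernel H) _ _ _ (b `^ (2 * H))) => //.
- exact: measurable_fbm_kernel.
- by move=> z z'; exact: normr_fbm_kernel_le.
move=> z z' zab z'ab; rewrite fbm_kernel_ge//=.
have [/andP[az zb] /andP[az' z'b]] := (zab, z'ab).
rewrite (le_trans (ler_norm _))// normr_fbm_kernel_le//.
- by rewrite zb (le_trans a0 (ltW az)).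
- by rewrite z'b (le_trans a0 (ltW az')).
Qed.

End fractional_kernels.

(** * Consequences of quasi-uniformity *)

(** Meant for the exponent [2 * H - 1], which can have either sign. The range from [C^-1] to [C] is
    stable under inversion, so a negative exponent reduces to a positive one. *)
Lemma powR_between (R : realType) (C u p : R) : 1 <= C -> C^-1 <= u <= C ->
  (C `^ `|p|)^-1 <= u `^ p <= C `^ `|p|.
Proof.
move=> C1 /andP[Cu uC]; have C0 : 0 < C by exact: lt_le_trans C1.
have Cinv0 : 0 < C^-1 by rewrite invr_gt0.
have u0 : 0 < u by exact: lt_le_trans Cu.
wlog p0 : p u Cu uC u0 / 0 <= p => [W|].
  have [/W|p0] := leP 0 p; first exact.
  have -> : u `^ p = u^-1 `^ (- p).
    by rewrite -(powR_inv1 (ltW u0)) -powRrM mulN1r opprK.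
  rewrite -normrN; apply: W; rewrite ?invr_gt0 ?oppr_ge0 ?(ltW p0)//.
  - by rewrite lef_pV2 ?posrE.
  - by rewrite invf_ple ?posrE.
have mono v w := @powR_nondecreasing R p v w p0.
rewrite ger0_norm//; apply/andP; split; last by rewrite mono ?(ltW u0).
by rewrite -powRN -[- p]mulN1r powRrM powR_inv1 ?(ltW C0)// mono ?invr_ge0 ?(ltW C0).
Qed.

(** The mean mesh size [T / N] lies between the smallest and the largest mesh, and quasi-uniformity
    makes the largest at most [C] times the smallest. *)
Lemma partition_mesh_bounds (R : realType) (T : R) (x : nat -> nat -> R) :
  0 < T -> (forall N, (0 < N)%N -> is_partition T N (x N)) ->
  quasi_uniform x ->
  exists2 C : R, 1 <= C & forall N n, (n < N)%N ->
    C^-1 * (T / N%:R) <= mesh (x N) n <= C * (T / N%:R).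
Proof.
move=> T0 xP [C C1 supC]; exists C => // N n nN.
have N0 : (0 < N)%N by exact: leq_ltn_trans nN.
have [_ _ xlt] := xP _ N0.
have C0 : 0 < C by exact: lt_le_trans C1.
have mesh0 i : (i < N)%N -> 0 < mesh (x N) i by move=> iN; rewrite subr_gt0 xlt.
have min0 : 0 < min_mesh N (x N).
  rewrite /min_mesh; elim/big_ind : _ => [|u v u0 v0|i _]; rewrite ?mesh0//.
  by rewrite lt_min u0.
have min_le i : (i < N)%N -> min_mesh N (x N) <= mesh (x N) i.
  by move=> iN; exact: (bigmin_le _ (Ordinal iN) (fun i : 'I_N => mesh (x N) i)).
have le_max i : (i < N)%N -> mesh (x N) i <= max_mesh N (x N).
  by move=> iN; exact: (le_bigmax _ (fun i : 'I_N => mesh (x N) i) (Ordinal iN)).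
have ratio : max_mesh N (x N) <= C * min_mesh N (x N).
  rewrite -ler_pdivrMr// -lee_fin -supC; apply: ereal_sup_ubound.
  by exists N.
have sumT := sum_mesh (xP _ N0).
have NR : 0 < N%:R :> R by rewrite ltr0n.
have T_le : T <= N%:R * max_mesh N (x N).
  rewrite -sumT mulr_natl -[X in _ *+ X]card_ord -sumr_const.
  by apply: ler_sum => i _; exact: le_max.
have le_T : N%:R * min_mesh N (x N) <= T.
  rewrite -sumT mulr_natl -[X in X <= _ ](_ : \sum_(i < N) min_mesh N (x N) = _).
    by apply: ler_sum => i _; exact: min_le.
  by rewrite sumr_const card_ord.
apply/andP; split.
- rewrite ler_pdivrMl// (le_trans _ (_ : C * min_mesh N (x N) <= _))//.
    by rewrite (le_trans _ ratio)// ler_pdivrMr// mulrC.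
  by rewrite ler_pM2l// min_le.
- rewrite (le_trans (le_max _ nN))// (le_trans ratio)// ler_pM2l//.
  by rewrite ler_pdivlMr// mulrC.
Qed.

(** * The expected estimator as a sum of increment variances *)

(** For a centered process with covariance [k], the variance of the increment over cell [n]. The two
    mixed terms stay separate, matching the bounds on double integrals. *)
Definition increment_var (R : realType) (k : R -> R -> R) (x : nat -> R)
    (n : nat) : R :=
  k (x n.+1) (x n.+1) - k (x n.+1) (x n) - (k (x n) (x n.+1) - k (x n) (x n)).

Section expectation_of_the_estimator.
Context (R : realType) (d : measure_display) (Omega : measurableType d)
  (P : probability Omega R) (T : R) (k : R -> R -> R) (f : R -> {RV P >-> R}).
Hypothesis T_ge0 : 0 <= T.
Hypothesis f_mean : forall t, 0 <= t <= T -> ('E_P[f t] = 0)%E.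
Hypothesis f_cov : forall s t, 0 <= s <= T -> 0 <= t <= T ->
  covariance P (f s) (f t) = (k s t)%:E.
Hypothesis k0 : forall t, k 0 t = 0.
Variables (N : nat) (x : nat -> R).
Hypothesis x_part : is_partition T N x.

(* [f 0] vanishes only almost surely, while the quadratic form needs the value
   [0] at [x 0 = 0]. *)
Let X (n : nat) : Omega -> R := if n is 0%N then cst 0 else f (x n).

Let x_itv n : (n <= N)%N -> 0 <= x n <= T.
Proof.
move=> nN; have [x0 xN _] := x_part.
by rewrite -x0 -xN !(partition_le x_part).
Qed.

(** Symmetry is inherited from the covariance of the process, so no exchange of integrals is needed
    for the integrated kernel. *)
Let k_sym s t : 0 <= s <= T -> 0 <= t <= T -> k s t = k t s.
Proof. by move=> sT tT; apply: EFin_inj; rewrite -!f_cov// covarianceC. Qed.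

Let X_moment m n : (m <= N)%N -> (n <= N)%N ->
  ('E_P[X m \* X n] = (k (x m) (x n))%:E)%E.
Proof.
have [x0 _ _] := x_part; move=> mN nN.
have E0 (Y Z : Omega -> R) : (forall w, Y w * Z w = 0) -> ('E_P[Y \* Z] = 0)%E.
  move=> YZ; rewrite (_ : Y \* Z = cst 0) ?expectation_cst//.
  by apply/funext => w /=.
case: m mN => [|m] mN.
  by rewrite x0 k0 E0// => w; rewrite mul0r.
case: n nN => [|n] nN.
  rewrite x0 k_sym ?k0 ?E0 ?lexx//; last exact: x_itv.
  by move=> w; rewrite mulr0.
by apply: expectation_centered_mul; rewrite ?f_mean ?f_cov ?x_itv.
Qed.

Let X_Lfun2 n : (n <= N)%N -> X n \in Lfun P 2%:E.
Proof.
move=> nN; have := X_moment nN nN.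
case: n nN => [_ _|n nN EX]; first exact: Lfun_cst.
by apply: Lfun2_second_moment; rewrite EX ltry.
Qed.

Let X_increment n : (n < N)%N ->
  ('E_P[fun w => ((X n.+1 w - X n w) ^+ 2)%R] = (increment_var k x n)%:E)%E.
Proof.
move=> nN; have nN' := ltnW nN; rewrite /increment_var.
(* [expectation_sqr_sub] contains one mixed moment twice, so the two mixed terms are first made
   equal by symmetry. *)
rewrite [X in X - _ - _]lock -[X in _ - (X - _)](k_sym (x_itv nN) (x_itv nN')).
rewrite -lock.
by apply: expectation_sqr_sub; rewrite ?X_Lfun2 ?X_moment// k_sym ?x_itv.
Qed.

(** The positivity comes from the process: the quantity is the expectation of a squared
    increment. *)
Lemma increment_var_ge0 n : (n < N)%N -> 0 <= increment_var k x n.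
Proof.
move=> nN; rewrite -lee_fin -X_increment//.
by apply: expectation_ge0 => w; exact: sqr_ge0.
Qed.

Lemma expectation_sigma2_ML :
  ('E_P[fun w => sigma2_ML (@bm_kernel R) (fun i : 'I_N => x i.+1)
                   (fun t => f t w)] =
   ((\sum_(n < N) increment_var k x n / mesh x n) / N%:R)%:E)%E.
Proof.
rewrite -(@expectation_weighted_sum _ _ _ P _
  (fun (n : 'I_N) w => X n.+1 w - X n w)).
- congr expectation; apply/funext => w.
  (* The estimator samples only [x 1], ..., [x N], so this identity holds at every [w], not just
     almost surely. *)
  exact: (sigma2_ML_bm (g := fun n => X n w) x_part).
- move=> n; have LX := X_Lfun2 (ltn_ord n).
  have LX' := X_Lfun2 (ltnW (ltn_ord n)).
  suff : X n.+1 \- X n \in Lfun P 2%:E by [].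
  by rewrite rpredB ?lee1n.
- by move=> n; rewrite X_increment.
Qed.

End expectation_of_the_estimator.

(** * Growth rates for both kernels *)

(** The ordering of the two constants required by [is_Theta] is obtained by enlarging [C] to the
    maximum, which is harmless as [b] is nonnegative. *)
Lemma is_Theta_fine (R : realType) (a : nat -> \bar R) (a' b : nat -> R) (c C : R) :
  0 < c -> (forall N, 0 <= b N) -> (forall N, (0 < N)%N -> a N = (a' N)%:E) ->
  (\forall N \near \oo, c * b N <= a' N <= C * b N) -> is_Theta a b.
Proof.
move=> c0 b0 aE ab; exists c, (Num.max c C); split; rewrite ?le_max ?lexx//.
near=> N; rewrite aE ?lee_fin.
  have /andP[-> aC] : c * b N <= a' N <= C * b N by near: N.
  by rewrite (le_trans aC)// ler_wpM2r// le_max lexx orbT.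
by near: N; exact: nbhs_infty_gt.
Unshelve. all: by end_near.
Qed.

Section rates.
Context (R : realType) (T : R) (T_gt0 : 0 < T) (x : nat -> nat -> R).
Hypothesis x_part : forall N, (0 < N)%N -> is_partition T N (x N).
Variable C : R.
Hypothesis C1 : 1 <= C.
Hypothesis x_mesh : forall N n, (n < N)%N ->
  C^-1 * (T / N%:R) <= mesh (x N) n <= C * (T / N%:R).
Variables (H : R) (H_gt0 : 0 < H).

Let C0 : 0 < C. Proof. exact: lt_le_trans C1. Qed.

Let H2_ge0 : 0 <= 2 * H. Proof. by rewrite mulr_ge0// ltW. Qed.

(** Every term equals [D]^ p[for a mesh]D[comparable to]T / N[, hence lies within a factor]K[of](T /
    N) [^ p]; an average of [N] such terms stays in the same range. *)
Lemma rate_fbm N p K : (0 < N)%N -> p = 2 * H - 1 -> K = C `^ `|p| ->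
  T `^ p * K^-1 * N%:R `^ (1 - 2 * H) <=
  (\sum_(n < N) increment_var (fbm_kernel H) (x N) n / mesh (x N) n) / N%:R
  <= T `^ p * K * N%:R `^ (1 - 2 * H).
Proof.
move=> N0 pE KE; have NR : 0 < N%:R :> R by rewrite ltr0n.
have [x0 xN x_lt] := x_part N0.
have term (n : 'I_N) : T `^ p * K^-1 * N%:R `^ (1 - 2 * H) <=
    increment_var (fbm_kernel H) (x N) n / mesh (x N) n <=
    T `^ p * K * N%:R `^ (1 - 2 * H).
  have nN := ltn_ord n; set D := mesh (x N) n.
  have D0 : 0 < D by rewrite subr_gt0 x_lt.
  have -> : increment_var (fbm_kernel H) (x N) n / D = D `^ p.
    rewrite /increment_var fbm_increment// gtr0_norm// pE powRB.
      by rewrite powRr1 ?ltW.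
    by apply/implyP => _; rewrite gt_eqF.
  have -> : 1 - 2 * H = - p by rewrite pE opprB.
  have TN0 : 0 < T / N%:R by rewrite divr_gt0.
  have /andP[uC Cu] : K^-1 <= (D / (T / N%:R)) `^ p <= K.
    rewrite KE; apply: powR_between => //.
    by rewrite ler_pdivlMr// ler_pdivrMr// x_mesh.
  have -> : D = (T / N%:R) * (D / (T / N%:R)) by rewrite mulrC divfK// gt_eqF.
  have TNE : (T / N%:R) `^ p = T `^ p * N%:R `^ (- p).
    rewrite powRM ?ltW ?invr_gt0//; congr (_ * _).
    by rewrite -powR_inv1 ?ltW// -powRrM mulN1r.
  rewrite powRM ?(ltW TN0) ?(ltW (divr_gt0 D0 TN0))//.
  rewrite (mulrAC (T `^ p) K^-1) (mulrAC (T `^ p) K) -TNE.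
  by rewrite !ler_pM2l ?powR_gt0// uC.
have sumE (c : R) : c * N%:R = \sum_(n < N) c.
  by rewrite sumr_const card_ord mulr_natr.
rewrite ler_pdivlMr// ler_pdivrMr// !sumE.
by apply/andP; split; apply: ler_sum => n _; have /andP[] := term n.
Qed.

Let x_le N n : (n < N)%N -> [/\ 0 <= x N n, x N n <= x N n.+1,
  x N n.+1 <= T & 0 < mesh (x N) n].
Proof.
move=> nN; have N0 : (0 < N)%N by exact: leq_ltn_trans nN.
have [x0 xN x_lt] := x_part N0; have le_x := partition_le (x_part N0).
by rewrite -{1}x0 -xN subr_gt0 x_lt// !le_x// ltnW.
Qed.

Let ifbm_term N n : (n < N)%N ->
  x N n `^ (2 * H) - mesh (x N) n `^ (2 * H) / 2 <=
  increment_var (ifbm_kernel H) (x N) n / mesh (x N) n ^+ 2 <= T `^ (2 * H).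
Proof.
move=> nN; have [x0 xx xT D0] := x_le nN.
have xx0 : 0 <= x N n <= x N n.+1 by rewrite x0.
have /andP[h1 h2] := ifbm_increment_bounds H_gt0 xx0.
have D20 : 0 < mesh (x N) n ^+ 2 by rewrite exprn_gt0.
rewrite ler_pdivlMr// ler_pdivrMr// h1/= (le_trans h2)// ler_pM2r//.
exact: powR_nondecreasing (le_trans x0 xx) xT.
Qed.

Lemma rate_ifbm_le N : (0 < N)%N ->
  (\sum_(n < N) increment_var (ifbm_kernel H) (x N) n / mesh (x N) n) / N%:R
  <= T `^ (2 * H) * T * N%:R^-1.
Proof.
move=> N0; rewrite ler_pM2r ?invr_gt0 ?ltr0n//.
have sumT := sum_mesh (x_part N0).
rewrite -[X in _ <= _ * X]sumT mulr_sumr; apply: ler_sum => n _.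
have [_ _ _ D0] := x_le (ltn_ord n); have /andP[_] := ifbm_term (ltn_ord n).
by rewrite !ler_pdivrMr ?exprn_gt0// expr2 mulrA.
Qed.

(** For [N <= 2 * n] the node satisfies [x N n >= T / (2 * C)], and the threshold on [N] makes every
    mesh at most [T / (2 * C)]. The factor [3] accounts for rounding when the cells of the second
    half are counted. *)
Lemma rate_ifbm_ge N : 2 * C ^+ 2 <= N%:R ->
  (forall n, (n < N)%N -> 0 <= increment_var (ifbm_kernel H) (x N) n) ->
  (T / (2 * C)) `^ (2 * H) / 2 * (C^-1 * T / 3) * N%:R^-1 <=
  (\sum_(n < N) increment_var (ifbm_kernel H) (x N) n / mesh (x N) n) / N%:R.
Proof.
move=> CN v0; set c := _ `^ _ / 2.
have C2 : 1 <= C ^+ 2 by rewrite exprn_ege1.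
have N1 : (1 < N)%N by rewrite -(ltr_nat R); lra.
have N0 : (0 < N)%N := ltnW N1.
have NR : 0 < N%:R :> R by rewrite ltr0n.
have [x0 xN _] := x_part N0.
have c0 : 0 < c by rewrite divr_gt0// powR_gt0// divr_gt0// mulr_gt0.
have x_ge n : (n <= N)%N -> n%:R * (C^-1 * (T / N%:R)) <= x N n.
  elim: n => [|n IH] nN; first by rewrite mul0r x0.
  have /andP[h _] := x_mesh nN.
  by rewrite -natr1 mulrDl mul1r -[leRHS](subrK (x N n)) addrC lerD// IH// ltnW.
have term n : (n < N)%N -> (N <= 2 * n)%N ->
    c * (C^-1 * (T / N%:R)) <=
    increment_var (ifbm_kernel H) (x N) n / mesh (x N) n.
  move=> nN Nn; have [xn0 _ _ D0] := x_le nN.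
  have /andP[D_ge D_le] := x_mesh nN.
  have /andP[+ _] := ifbm_term nN.
  set D := mesh _ _ in D0 D_ge D_le *; set v := increment_var _ _ _ => v_ge.
  have TC0 : 0 < T / (2 * C) by rewrite divr_gt0// mulr_gt0.
  have xnC : T / (2 * C) <= x N n.
    rewrite (le_trans _ (x_ge _ (ltnW nN)))//.
    have -> : n%:R * (C^-1 * (T / N%:R)) = T / (2 * C) * ((2 * n)%:R / N%:R).
      by rewrite natrM; field; rewrite !gt_eqF.
    by rewrite ler_peMr ?(ltW TC0)// ler_pdivlMr// mul1r ler_nat.
  have DC : D <= T / (2 * C).
    rewrite (le_trans D_le)//.
    have -> : C * (T / N%:R) = T / (2 * C) * (2 * C ^+ 2 / N%:R).
      by field; rewrite !gt_eqF.
    by rewrite ler_piMr ?(ltW TC0)// ler_pdivrMr// mul1r.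
  have h1 := powR_nondecreasing H2_ge0 (ltW TC0) xnC.
  have h2 := powR_nondecreasing H2_ge0 (ltW D0) DC.
  (* With [A] the power of [T / (2 * C)], the lower bound is at least [A - A / 2], which is [c]. *)
  have cv : c <= v / D ^+ 2 by apply: le_trans v_ge; rewrite /c; lra.
  have -> : v / D = v / D ^+ 2 * D by field; rewrite gt_eqF.
  by rewrite ler_pM// ?(ltW c0)// mulr_ge0 ?invr_ge0 ?divr_ge0 ?ltW.
rewrite ler_pM2r ?invr_gt0// -(big_mkord xpredT
  (fun n => increment_var (ifbm_kernel H) (x N) n / mesh (x N) n)).
(* Cutting at [N] minus the floor of [N / 2] guarantees [N <= 2 * n] on the upper block; the lower
   block is only used to be nonnegative. *)
rewrite (@big_cat_nat _ _ _ (N - N %/ 2)) ?leq_subr//=.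
rewrite -[leLHS]add0r lerD//.
  rewrite big_seq sumr_ge0// => n; rewrite mem_index_iota => /andP[_ nN].
  have {}nN : (n < N)%N by rewrite (leq_trans nN)// leq_subr.
  have [_ _ _ D0] := x_le nN.
  by rewrite divr_ge0 ?v0 ?ltW.
apply: (@le_trans _ _ (\sum_(N - N %/ 2 <= n < N) c * (C^-1 * (T / N%:R)))).
  rewrite sumr_const_nat -[leRHS]mulr_natr -[leRHS]mulrA ler_pM2l//.
  have -> : C^-1 * (T / N%:R) * (N - (N - N %/ 2))%:R =
     C^-1 * T / 3 * ((3 * (N - (N - N %/ 2)))%:R / N%:R).
    by rewrite natrM; field; rewrite !gt_eqF.
  have CT : 0 < C^-1 * T / 3 by rewrite divr_gt0// mulr_gt0// invr_gt0.
  (* The upper block has [N %/ 2] cells, at least a third of [N] because [N >= 2]. *)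
  by rewrite ler_peMr ?(ltW CT)// ler_pdivlMr// mul1r ler_nat; lia.
rewrite big_seq [leRHS]big_seq; apply: ler_sum => n.
rewrite mem_index_iota => /andP[mn nN]; apply: term => //; lia.
Qed.

End rates.

Theorem theorem12 (R : realType) (d : measure_display)
    (Omega : measurableType d) (P : probability Omega R)
    (T : R) (T_gt0 : 0 < T)
    (x : nat -> nat -> R)
    (x_part : forall N : nat, (0 < N)%N -> is_partition T N (x N))
    (x_qu : quasi_uniform x)
    (l : nat) (l01 : l = 0%N \/ l = 1%N)
    (H : R) (H01 : 0 < H < 1)
    (f : R -> {RV P >-> R})
    (f_gp : gaussian_process `[0, T] (fun _ => 0) (hurst_kernel l H) f) :
  let E_ML (N : nat) : \bar R :=
    ('E_P[fun w => sigma2_ML (@bm_kernel R) (fun i : 'I_N => x N i.+1)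
                    (fun t => f t w)])%E in
  [/\ is_Theta E_ML (fun N => N%:R `^ (1 - Num.min (2 * (l%:R + H)) 2)),
      l = 0%N -> is_Theta E_ML (fun N => N%:R `^ (1 - 2 * H))
    & l = 1%N -> is_Theta E_ML (fun N => N%:R^-1)].
Proof.
have [H0 _] := andP H01.
have [C C1 x_mesh] := partition_mesh_bounds T_gt0 x_part x_qu.
have C0 : 0 < C by exact: lt_le_trans C1.
have [_ f_mean f_cov] := f_gp.
have itvP t : 0 <= t <= T -> `[0, T]%classic t by rewrite /= in_itv.
have mean t tT : ('E_P[f t] = 0)%E := f_mean t (itvP t tT).
have cov s t sT tT : covariance P (f s) (f t) = _ :=
  f_cov s t (itvP s sT) (itvP t tT).
move=> E_ML.
have k0 t : hurst_kernel l H 0 t = 0.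
  by rewrite /hurst_kernel; case: ifP => _; rewrite ?fbm_kernel0 ?ifbm_kernel0.
pose S N :=
  (\sum_(n < N) increment_var (hurst_kernel l H) (x N) n / mesh (x N) n) / N%:R.
have E_MLE N : (0 < N)%N -> E_ML N = (S N)%:E.
  by move=> N0; apply: (expectation_sigma2_ML (ltW T_gt0) mean cov k0 (x_part N N0)).
have S_fbm : l = 0%N -> is_Theta E_ML (fun N => N%:R `^ (1 - 2 * H)).
  move=> l0; pose p := 2 * H - 1; pose K := C `^ `|p|.
  apply: (@is_Theta_fine _ _ S _ (T `^ p * K^-1) (T `^ p * K)) => //.
    by rewrite divr_gt0// powR_gt0.
  near=> N; rewrite /S l0; apply: (rate_fbm T_gt0 x_part C1 x_mesh) => //.
  by near: N; exact: nbhs_infty_gt.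
have S_ifbm : l = 1%N -> is_Theta E_ML (fun N => N%:R^-1).
  move=> l1; pose c := (T / (2 * C)) `^ (2 * H) / 2 * (C^-1 * T / 3).
  have c_gt0 : 0 < c.
    have TC0 : 0 < T / (2 * C) by rewrite divr_gt0// mulr_gt0.
    by rewrite mulr_gt0 ?divr_gt0 ?powR_gt0// mulr_gt0// invr_gt0.
  apply: (@is_Theta_fine _ _ S _ c (T `^ (2 * H) * T)) => //.
  near=> N.
  have N0 : (0 < N)%N by near: N; exact: nbhs_infty_gt.
  (* This is the threshold beyond which all meshes are small enough for the lower bound. *)
  have N_ge : 2 * C ^+ 2 <= N%:R by near: N; exact: nbhs_infty_ger.
  have v_ge0 n : (n < N)%N -> _ :=
    @increment_var_ge0 _ _ _ _ _ _ _ (ltW T_gt0) mean cov k0 _ _ (x_part N N0) n.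
  rewrite /S; rewrite l1 in v_ge0 *.
  by rewrite rate_ifbm_ge// (rate_ifbm_le x_part).
split => //; case: l01 => l_eq.
- rewrite l_eq add0r min_l; first exact: S_fbm.
  by move: H01; lra.
- rewrite l_eq min_r; last by move: H01; lra.
  (* The exponent is [1 - 2 = -1]. The functions also agree at [N = 0], where the power and the
     inverse are both [0]. *)
  rewrite (_ : (fun N => _) = fun N => N%:R^-1); first exact: S_ifbm.
  apply/funext => N; rewrite -powR_inv1//; congr powR; lra.
Unshelve. all: by end_near.
Qed.
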